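(* Assume the setting of the context (random weights). Fix a compact interval $I\subset(0,\infty)$ and $r,\varepsilon>0$, and suppose Assumptions (A1R) and (A2R) hold. Then \[\lim_{n\rightarrow\infty}\mathbb{P}_{\mu}\left(\sup_{x\in B_F(\rho,r)}\sup_{t\in I}\left|\beta(n)q^n_{\lfloor\gamma(n)t\rfloor}(g_n(x))-q_t(x)\right|>\varepsilon\right)=0.\]
   Context: Let $(E,d_E)$ be a metric space and $F\subseteq E$ such that $F\cap\overline{B}_E(x,r)$ is compact for all $x\in E$, $r>0$ ($\overline{B}_E$, $B_E$ closed and open balls in $E$). Let $d_F:=d_E|_{F\times F}$, $B_F(x,r)$ the open ball in $(F,d_F)$, $\rho\in F$, $\nu$ a Radon measure of full support on $(F,d_F)$ (extended to $E$ by $\nu(A):=\nu(A\cap F)$), and $(q_t(x))_{x\in F,t>0}$ jointly continuous in $(t,x)$ with $q_t\ge0$, $\int_Fq_t\,d\nu=1$ for each $t>0$. For a locally finite connected graph $G$ with at least two vertices and distinguished vertex $\rho(G)$: $d_G$ is the shortest-path metric, $B_G(x,r)$ the open $d_G$-ball; $\mu^G$ a symmetric weight with $\mu^G_{xy}>0$ iff $\{x,y\}$ is an edge; $\mu^G_x:=\sum_y\mu^G_{xy}$; $\nu^G(A):=\sum_{x\in A}\mu^G_x$; $X^G$ the discrete time simple random walk with $P_G(x,y)=\mu^G_{xy}/\mu^G_x$, law $\mathbf{P}^G_x$; $p^G_m(x,y):=\mathbf{P}^G_x(X^G_m=y)/\nu^G(\{y\})$, $q^G_m(x,y):=\frac12(p^G_m+p^G_{m+1})(x,y)$,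 $q^G_m(x):=q^G_m(\rho(G),x)$. $(G^n)_{n\ge1}$ are such graphs with $V(G^n)\subseteq E$, $\rho(G^n)=\rho$; write $\nu^n,X^n,q^n$ for $\nu^{G^n},X^{G^n},q^{G^n}$. The weights of all the $G^n$ are random, given by a random element of $(0,\infty)^{\cup_nE(G^n)}$ with law $\mathbb{P}_\mu$; hence $\nu^n$, $\mathbf{P}^{G^n}$, $q^n$ are random. $(\alpha(n)),(\beta(n)),(\gamma(n))$ are non-negative deterministic sequences diverging to $\infty$. For $x\in E$, $g_n(x)$ is a point of $V(G^n)$ minimising $d_E(x,\cdot)$. Assumption (A1R): (a) there is $c_1>0$ with $d_{G^n}(x,y)\ge c_1\alpha(n)d_E(x,y)$ for all $x,y\in V(G^n)$, $n\ge1$, and a non-negative $\tilde\alpha(n)=o(\alpha(n))$ such that for each $r>0$ there are $c_2<\infty$, $n_0$ with $d_{G^n}(x,y)\le c_2\alpha(n)d_E(x,y)+\tilde\alpha(n)$ for all $x,y\in V(G^n)\cap B_E(\rho,r)$, $n\ge n_0$; (b) for each $r>0$, $\lim_n\sup_{x\in B_F(\rho,r)}d_E(x,V(G^n))=0$; (c) for every $x\in F$, $r,\varepsilon>0$, $\lim_n\mathbb{P}_\mu(|\beta(n)^{-1}\nu^n(B_E(x,r))-\nu(B_E(x,r))|>\varepsilon)=0$; (d) for every compact interval $I\subset(0,\infty)$, $x\in F$, $r,\varepsilon>0$, \[\lim_n\mathbb{P}_\mu\Big(\sup_{t\in I}\Big|\mathbf{P}^{G^n}_\rho(X^n_{\lfloor\gamma(n)t\rfloor}\in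 B_E(x,r))-\int_{B_E(x,r)}q_t(y)\nu(dy)\Big|>\varepsilon\Big)=0.\] Assumption (A2R): for every compact interval $I\subset(0,\infty)$ and $r,\varepsilon>0$, \[\lim_{\delta\to0}\limsup_{n\to\infty}\mathbb{P}_\mu\Big(\sup_{\substack{x,y\in B_{G^n}(\rho,\alpha(n)r):\\ d_{G^n}(x,y)\le\alpha(n)\delta}}\sup_{t\in I}\beta(n)\big|q^n_{\lfloor\gamma(n)t\rfloor}(x)-q^n_{\lfloor\gamma(n)t\rfloor}(y)\big|>\varepsilon\Big)=0.\] *)

(* Defs.v *)
From HB Require Import structures.
From mathcomp Require Import all_boot all_order all_algebra.
From mathcomp Require Import all_classical all_reals all_analysis.
Set Implicit Arguments.
Unset Strict Implicit.
Unset Printing Implicit Defensive.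
Import Order.TTheory GRing.Theory Num.Theory.
Import numFieldNormedType.Exports.
Local Open Scope classical_set_scope.
Local Open Scope ring_scope.

Section MetricDefs.
Context {R : realType} {E : choiceType}.
Implicit Types (d : E -> E -> R) (A F K U : set E).

Definition is_metric d : Prop :=
  [/\ forall x y, 0 <= d x y,
      forall x y, d x y = 0 <-> x = y,
      forall x y, d x y = d y x &
      forall x y z, d x z <= d x y + d y z].

Definition ballE d (x : E) (r : R) : set E := [set y | d x y < r].
Definition cballE d (x : E) (r : R) : set E := [set y | d x y <= r].
Definition ballF d F (x : E) (r : R) : set E := ballE d x r `&` F.

Definition dopen d A : Prop :=
  forall x, A x -> exists2 r, 0 < r & ballE d x r `<=` A.

Definition rel_open d F U : Prop :=
  U `<=` F /\ forall x, U x -> exists2 r, 0 < r & ballF d F x r `<=` U.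

Definition dcompact d K : Prop :=
  forall (I : Type) (C : I -> set E), (forall i, dopen d (C i)) ->
    K `<=` \bigcup_i C i ->
    exists2 J : set I, finite_set J & K `<=` \bigcup_(i in J) C i.

Definition dist_set d (V : set E) (x : E) : R := inf [set d x v | v in V].

End MetricDefs.

Section MeasureDefs.
Context {R : realType} {dm : measure_display} {E : measurableType dm}.
Implicit Types (d : E -> E -> R) (F : set E).

(* nu is a Radon measure on (F,d_F) (Borel sets of F are the traces A `&` F):
   locally finite, outer regular, inner regular on open sets *)
Definition radon_on d F (nu : set E -> \bar R) : Prop :=
  [/\ forall x, F x -> exists2 r, 0 < r & (nu (ballF d F x r) < +oo)%E,
      forall A, measurable A -> A `<=` F ->
        nu A = ereal_inf [set nu U | U in [set U | rel_open d F U /\ A `<=` U]] &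
      forall U, rel_open d F U ->
        nu U = ereal_sup [set nu K | K in [set K | dcompact d K /\ K `<=` U]]].

Definition full_support d F (nu : set E -> \bar R) : Prop :=
  forall U, rel_open d F U -> U !=set0 -> (0 < nu U)%E.

Definition jcont_on d F (q : R -> E -> R) : Prop :=
  forall t x, 0 < t -> F x -> forall e, 0 < e -> exists2 del, 0 < del &
    forall s y, 0 < s -> F y -> `|s - t| < del -> d x y < del ->
      `|q s y - q t x| < e.

End MeasureDefs.

Section GraphDefs.
Context {R : realType} {E : choiceType}.
Implicit Types (V : set E) (adj : E -> E -> Prop) (w : E -> E -> R).

Inductive walk adj : nat -> E -> E -> Prop :=
  | walk0 x : walk adj 0 x x
  | walkS k x y z : adj x y -> walk adj k y z -> walk adj k.+1 x z.

Definition lf_conn_graph V adj : Prop :=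
  [/\ forall x y, adj x y -> V x /\ V y,
      forall x y, adj x y -> adj y x,
      forall x, V x -> finite_set [set y | adj x y],
      forall x y, V x -> V y -> exists k, walk adj k x y &
      exists x y, [/\ V x, V y & x <> y]].

Definition gdist adj (x y : E) : R :=
  inf [set (k%:R : R) | k in [set k | walk adj k x y]].

Definition ballG adj V (x : E) (s : R) : set E :=
  [set y | V y /\ gdist adj x y < s].

Definition weight_on adj w : Prop :=
  [/\ forall x y, w x y = w y x,
      forall x y, adj x y -> 0 < w x y &
      forall x y, ~ adj x y -> w x y = 0].

(* mu_x = sum_y mu_xy (finite sum by local finiteness) *)
Definition wdeg w (x : E) : R := \sum_(y \in [set: E]) w x y.

Definition trans w (x y : E) : R := w x y / wdeg w x.

Fixpoint tprob w (m : nat) (x y : E) : R :=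
  match m with
  | 0 => ((x == y) : nat)%:R
  | m'.+1 => \sum_(z \in [set: E]) trans w x z * tprob w m' z y
  end.

Definition walk_hit w (m : nat) (x : E) (B : set E) : R :=
  \sum_(y \in B) tprob w m x y.

Definition gmeasure V w (A : set E) : \bar R :=
  \esum_(x in A `&` V) (wdeg w x)%:E.

Definition hk w (m : nat) (x y : E) : R := tprob w m x y / wdeg w y.

Definition qk w (m : nat) (x y : E) : R := (hk w m x y + hk w m.+1 x y) / 2.

End GraphDefs.

Section Assumptions.
Context {R : realType} {dm : measure_display} {E : measurableType dm}
  {dO : measure_display} {Omega : measurableType dO}.
Variables (dE : E -> E -> R) (F : set E) (rho : E)
  (nu : {measure set E -> \bar R}) (q : R -> E -> R)
  (V : nat -> set E) (adj : nat -> E -> E -> Prop)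
  (P : probability Omega R) (w : nat -> Omega -> E -> E -> R)
  (alpha beta gamma : nat -> R).

Definition A1R : Prop :=
  [/\ (exists2 c1, 0 < c1 & forall n x y, V n x -> V n y ->
          c1 * alpha n * dE x y <= gdist (adj n) x y)
   /\ (exists alphat : nat -> R, [/\ forall n, 0 <= alphat n,
          alphat =o_\oo alpha &
          forall r, 0 < r -> exists c2 : R, exists n0 : nat,
            forall n, (n0 <= n)%N -> forall x y,
              V n x -> V n y -> ballE dE rho r x -> ballE dE rho r y ->
              gdist (adj n) x y <= c2 * alpha n * dE x y + alphat n]),
   (forall r : R, 0 < r ->
      ereal_sup [set (dist_set dE (V n) x)%:E | x in ballF dE F rho r]
        @[n --> \oo] --> 0%E),
   (forall x (r eps : R), F x -> 0 < r -> 0 < eps ->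
      P [set om | (eps%:E < `| ((beta n)^-1)%:E * gmeasure (V n) (w n om) (ballE dE x r)
                              - nu (ballE dE x r) |)%E]
        @[n --> \oo] --> 0%E) &
   (forall (a b : R) x (r eps : R), 0 < a -> a <= b -> F x -> 0 < r -> 0 < eps ->
      P [set om | (eps%:E < ereal_sup
           [set `| (walk_hit (w n om) (Num.truncn (gamma n * t)) rho (ballE dE x r))%:E
                   - \int[nu]_(y in ballE dE x r `&` F) (q t y)%:E |%E
           | t in `[a, b]])%E]
        @[n --> \oo] --> 0%E)].

Definition A2R : Prop :=
  forall a b r eps : R, 0 < a -> a <= b -> 0 < r -> 0 < eps ->
    limn_esup (fun n => P [set om | (eps%:E < ereal_sup
       [set ereal_sup
          [set (beta n * `| qk (w n om) (Num.truncn (gamma n * t)) rho xy.1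
                          - qk (w n om) (Num.truncn (gamma n * t)) rho xy.2 |)%:E
          | t in `[a, b]]
       | xy in [set xy : E * E |
           [/\ ballG (adj n) (V n) rho (alpha n * r)%R xy.1,
               ballG (adj n) (V n) rho (alpha n * r)%R xy.2 &
               (gdist (adj n) xy.1 xy.2 <= alpha n * delta)%R]]])%E])
      @[delta --> (0:R)^'+] --> 0%E.

End Assumptions.

(* Main.v *)
Require Import Defs.
From HB Require Import structures.
From mathcomp Require Import all_boot all_order all_algebra.
From mathcomp Require Import all_classical all_reals all_analysis.
From mathcomp Require Import measurable_realfun lra.
Import Order.TTheory GRing.Theory Num.Theory.
Import numFieldNormedType.Exports.
Local Open Scope classical_set_scope.
Local Open Scope ring_scope.

(** The ball [B] of a small radius [del] around a centre [c] of a finite [del]-net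
    of [F /\ cball(rho, r)] satisfies
      [sum_(y in B) q^n_m(y) mu_y = (P(X_m in B) + P(X_(m+1) in B)) / 2].
    The right-hand side is close to the integral of [q_t] over [B], by hypothesis
    (A1R)(d) at the times [t] and [t + 1/gamma(n)], hence close to
    [q_t(x) nu(B)] by uniform continuity of [q]; the left-hand side is close to
    [beta(n) q^n_m(g_n(x)) nu^n(B) / beta(n)] by equicontinuity (A2R), because
    graph distances on [B] are at most of order [alpha(n) del]; and
    [nu^n(B) / beta(n)] is close to [nu(B) > 0]. Dividing by [nu(B)] bounds the
    deviation by [eps] off finitely many exceptional events. A union bound
    concludes; as [P] is only monotone on measurable sets, each event, despite the
    uncountable suprema, has to be shown measurable. *)

(** * Compactness and regularity of the limit density *)

Lemma finite_min_pos {R : realType} {I : choiceType} (J : set I) (f : I -> R) :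
  finite_set J -> (forall i, J i -> 0 < f i) ->
  exists2 e : R, 0 < e & forall i, J i -> e <= f i.
Proof.
move=> /finite_seqP[s ->]; elim: s => [|i s IH] fpos; first by exists 1.
have [|e e0 Hs] := IH; first by move=> j js; apply: fpos; rewrite /= inE; apply/orP; right.
exists (Num.min e (f i)).
  by rewrite lt_min e0 fpos //= inE eqxx.
move=> j /=; rewrite inE => /orP[/eqP ->|js]; first by rewrite ge_min lexx orbT.
by rewrite ge_min Hs.
Qed.

Lemma dopen_ballE {R : realType} {E : choiceType} (d : E -> E -> R) x r :
  is_metric d -> dopen d (Defs.ballE d x r).
Proof.
move=> [_ _ _ dt] y /= dxy; exists (r - d x y); first by rewrite subr_gt0.
move=> z /= dyz; apply: (le_lt_trans (dt x y z)).
by rewrite addrC -ltrBrDr.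
Qed.

(** Each point has a ball whose radius is its own admissible [e]. Finitely many such balls cover
    [K], and by monotonicity the least of their radii is admissible everywhere. *)
Lemma dcompact_uniform {R : realType} {E : choiceType} (d : E -> E -> R) K
    (P : R -> E -> Prop) :
  is_metric d -> dcompact d K ->
  (forall e e' y, e <= e' -> P e' y -> P e y) ->
  (forall x, K x ->
     exists2 e, 0 < e & forall y, K y -> d x y < e -> P e y) ->
  exists2 e, 0 < e & forall y, K y -> P e y.
Proof.
move=> dm cK Pmono Ploc.
pose good (i : E * R) := 0 < i.2 /\ forall y, K y -> d i.1 y < i.2 -> P i.2 y.
(* Indexing by all pairs of centre and radius avoids choosing a radius for each point; bad pairs
   contribute the empty set. *)
pose C (i : E * R) := [set y | good i /\ d i.1 y < i.2].
have [||J finJ KJ] := cK _ C.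
- move=> i y [gi diy]; have [r r0 rb] := dopen_ballE d i.1 i.2 dm y diy.
  by exists r => // z /rb.
- move=> x Kx; have [e e0 He] := Ploc x Kx.
  exists (x, e) => //; split; first by split.
  by have [_ d0 _ _] := dm; rewrite /= (d0 x x).2.
have [||e e0 He] := @finite_min_pos _ _ (J `&` good) snd.
- exact: finite_setIl.
- by move=> i [_ []].
exists e => // y Ky; have [i Ji [gi diy]] := KJ y Ky.
by apply: Pmono (He i _) _ => //; apply: gi.2.
Qed.

Lemma dcompact_net {R : realType} {E : choiceType} (d : E -> E -> R) K (e : R) :
  is_metric d -> dcompact d K -> 0 < e ->
  exists J : set E, [/\ finite_set J, J `<=` K &
    forall y, K y -> exists2 i, J i & d i y < e].
Proof.
move=> dm cK e0.
have [||J finJ KJ] := cK _ (fun i => [set y | K i /\ d i y < e]).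
- move=> i y [Ki iy]; have [r r0 rb] := dopen_ballE d i e dm y iy.
  by exists r => // z /rb.
- by move=> y Ky; exists y => //; split => //; have [_ d0 _ _] := dm; rewrite (d0 y y).2.
exists (J `&` K); split => [|i []//|y /KJ[i Ji [Ki iy]]]; first exact: finite_setIl.
by exists i.
Qed.

(** In the near-covering form of compactness the admissible [e] runs along the filter [0^'+], so
    local validity near each time becomes validity at one common positive [e]. *)
Lemma segment_uniform {R : realType} (a b : R) (P : R -> R -> Prop) :
  (forall e e' s, e <= e' -> P e' s -> P e s) ->
  (forall t, a <= t <= b ->
     exists2 e, 0 < e & forall s, `|t - s| < e -> P e s) ->
  exists2 e, 0 < e & forall s, a <= s <= b -> P e s.
Proof.
move=> Pmono Ploc.
have := @segment_compact R a b; rewrite compact_near_coveringP.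
move=> /(_ R 0^'+ P _)[] => [t|].
  rewrite /= in_itv /= => /Ploc [e e0 He].
  exists ([set s | `|t - s| < e], [set e' | e' <= e]) => /=.
    split; first by apply/nbhs_ballP; exists e.
    exact: nbhs_right_le.
  by move=> [s e'] /= [ts ee']; apply: Pmono ee' _; apply: He.
move=> e0 /= e0p H.
exists (e0 / 2); first by rewrite divr_gt0.
move=> s sab; apply: (H (e0 / 2)); rewrite /= ?in_itv ?sab //=.
  by rewrite sub0r normrN ger0_norm; lra.
by rewrite divr_gt0.
Qed.

Lemma dcompact_segment_uniform {R : realType} {E : choiceType}
    (d : E -> E -> R) K (a b : R) (P : R -> R -> E -> Prop) :
  is_metric d -> dcompact d K ->
  (forall e e' t y, e <= e' -> P e' t y -> P e t y) ->
  (forall x t, K x -> a <= t <= b -> exists2 e, 0 < e &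
     forall y s, K y -> d x y < e -> `|t - s| < e -> P e s y) ->
  exists2 e, 0 < e & forall y s, K y -> a <= s <= b -> P e s y.
Proof.
move=> dm cK Pmono Ploc.
have [||e e0 He] := @dcompact_uniform _ _ d K
  (fun e y => forall s, a <= s <= b -> P e s y) dm cK.
- by move=> e e' y ee' H s sab; apply: Pmono ee' _; apply: H.
- move=> x Kx.
  have [||e e0 He] := @segment_uniform _ a b
    (fun e s => forall y, K y -> d x y < e -> P e s y).
  + move=> e e' s ee' H y Ky xy; apply: (Pmono _ e') => //; apply: H => //.
    exact: lt_le_trans xy ee'.
  + by move=> t /(Ploc x t Kx)[e e0 He]; exists e => // s ts y Ky xy; apply: He.
  by exists e => // y Ky xy s sab; apply: He.
by exists e => // y s Ky; apply: He.
Qed.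

Section HeatKernelRegularity.
Context {R : realType} {dm : measure_display} {E : measurableType dm}.
Variables (d : E -> E -> R) (F : set E) (q : R -> E -> R).
Hypotheses (dmet : is_metric d) (qc : jcont_on d F q).

(** The second point ranges over all of [F] and all positive times: small balls centred in [K] and
    slightly shifted times may leave [K] and [[a, b]]. *)
Lemma jcont_on_uniform K (a b e : R) : dcompact d K -> K `<=` F -> 0 < a -> 0 < e ->
  exists2 del, 0 < del & forall x t, K x -> a <= t <= b ->
    forall y s, 0 < s -> F y -> `|s - t| < del -> d x y < del ->
      `|q s y - q t x| < e.
Proof.
move=> cK KF a0 e0.
apply: (@dcompact_segment_uniform _ _ d K a b (fun del t x =>
  forall y s, 0 < s -> F y -> `|s - t| < del -> d x y < del ->
    `|q s y - q t x| < e) dmet cK).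
  move=> e1 e2 t y e12 H z s s0 Fz st yz.
  by apply: H => //; [exact: lt_le_trans st e12|exact: lt_le_trans yz e12].
move=> x t Kx /andP[at_ tb].
have t0 : 0 < t by exact: lt_le_trans a0 at_.
have e20 : 0 < e / 2 by rewrite divr_gt0.
have [del del0 H] := qc t x t0 (KF _ Kx) _ e20.
(* Half of [del] leaves room for the triangle inequality; the bound by [a] keeps the nearby time [s]
   positive. *)
exists (Num.min (del / 2) a); first by rewrite lt_min a0 divr_gt0.
have [_ _ ds dt] := dmet.
move=> y s Ky; rewrite !lt_min => /andP[xy _] /andP[ts ta] z u u0 Fz.
rewrite !lt_min => /andP[us _] /andP[yz _].
have s0 : 0 < s by move: ta; rewrite ltr_norml => /andP[] _ H1; lra.
have dd : del / 2 <= del by lra.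
have h1 : `|q s y - q t x| < e / 2.
  apply: H => //; first exact: KF.
    by rewrite distrC; apply: lt_le_trans ts dd.
  exact: lt_le_trans xy dd.
have h2 : `|q u z - q t x| < e / 2.
  apply: H => //.
    by have := ler_distD s u t; rewrite (distrC s t) => H1; lra.
  by have := dt x y z => H1; lra.
have := ler_distD (q t x) (q u z) (q s y); rewrite (distrC (q t x)) => H1; lra.
Qed.

Lemma jcont_on_bounded K (a b : R) : dcompact d K -> K `<=` F -> 0 < a ->
  exists M, forall x t, K x -> a <= t <= b -> `|q t x| <= M.
Proof.
move=> cK KF a0.
have [del del0 H] := @jcont_on_uniform K a b 1 cK KF a0 ltr01.
(* Writing the bound as [e^-1] makes it monotone in [e]; the alternative [e <= 0] preserves this
   where inversion is not decreasing. *)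
have [||e e0 He] := @dcompact_segment_uniform _ _ d K a b
  (fun e t x => `|q t x| <= e^-1 \/ e <= 0) dmet cK.
- move=> e e' t y ee' [|e'0]; last by right; exact: le_trans ee' e'0.
  case: (lerP e 0) => [_|e0]; first by right.
  by left; apply: le_trans _ (_ : e'^-1 <= _) => //; rewrite lef_pV2 // posrE (lt_le_trans e0).
- move=> x t Kx tab.
  pose M := `|q t x| + 1.
  have M0 : 0 < M by rewrite /M ltr_wpDl.
  exists (Num.min (Num.min a del) M^-1); first by rewrite !lt_min a0 del0 invr_gt0.
  move=> y s Ky; rewrite !lt_min -!andbA => /and3P[_ xy _] /and3P[tsa ts _].
  left; apply: (@le_trans _ _ M).
    have s0 : 0 < s.
      by move: tab tsa => /andP[at_ _]; rewrite ltr_norml => /andP[_ H1]; lra.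
    have := H x t Kx tab y s s0 (KF _ Ky); rewrite (distrC s t) => /(_ ts xy) H1.
    have := ler_distD (q t x) (q s y) 0; rewrite !subr0 /M => H2; lra.
  rewrite -[leLHS]invrK lef_pV2 ?posrE ?invr_gt0 ?lt_min ?invr_gt0 ?M0 ?a0 ?del0 //.
  by rewrite ge_min lexx orbT.
exists e^-1 => x t Kx tab; case: (He x t Kx tab) => // e0'.
by move: e0; rewrite ltNge e0'.
Qed.

End HeatKernelRegularity.

(** A point outside [F] has positive distance from the compact part of [F] in its closed unit ball,
    and the rest of [F] is at distance more than 1. *)
Lemma dopen_setC_proper {R : realType} {E : choiceType} (d : E -> E -> R) F :
  is_metric d -> (forall x r, 0 < r -> dcompact d (F `&` cballE d x r)) ->
  dopen d (~` F).
Proof.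
move=> dm cF x nFx; have [d0 d1 ds dt] := dm.
have [||e e0 He] := @dcompact_uniform _ _ d (F `&` cballE d x 1)
  (fun e y => e <= d x y) dm (cF x 1 ltr01).
- by move=> e e' y; exact: le_trans.
- move=> y [Fy _].
  have xy : 0 < d x y.
    by rewrite lt_neqAle d0 andbT eq_sym; apply/eqP => /d1 xy; apply: nFx; rewrite xy.
  exists (d x y / 2); first by rewrite divr_gt0.
  by move=> z _ yz; have := dt x z y; rewrite (ds z y) => H; lra.
exists (Num.min e 1); first by rewrite lt_min e0 /=.
move=> y; rewrite /Defs.ballE /= lt_min => /andP[ye y1] Fy.
have : e <= d x y by apply: He; split => //; exact: ltW.
by rewrite leNgt ye.
Qed.

(** * Random walks on weighted graphs *)

Lemma fsum_near_cst {R : realType} {E : choiceType} (D : set E) (f mu : E -> R) (c e : R) :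
  finite_set D -> (forall y, D y -> 0 <= mu y) ->
  (forall y, D y -> `|f y - c| <= e) ->
  `|\sum_(y \in D) f y * mu y - c * \sum_(y \in D) mu y| <= e * \sum_(y \in D) mu y.
Proof.
move=> finD mu0 fc; rewrite !fsbig_finite // !mulr_sumr -sumrB.
apply: (le_trans (ler_norm_sum _ _ _)); rewrite big_seq [leRHS]big_seq.
apply: ler_sum => y; rewrite in_fset_set // inE => Dy.
by rewrite -mulrBl normrM (ger0_norm (mu0 _ Dy)) ler_wpM2r ?mu0 ?fc.
Qed.

Section WeightedGraph.
Context {R : realType} {E : choiceType}.
Variables (V : set E) (adj : E -> E -> Prop).
Hypothesis graphG : lf_conn_graph V adj.

Lemma finite_adj x : finite_set [set y | adj x y].
Proof.
have [adjV _ lf _ _] := graphG.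
have [Vx|nVx] := pselect (V x); first exact: lf.
by apply: (sub_finite_set _ (finite_set0 E)) => y /= /adjV[].
Qed.

Lemma walk_stable k x y : V x -> walk adj k x y -> V y.
Proof.
have [adjV _ _ _ _] := graphG.
by move=> Vx wxy; elim: wxy Vx => // {k x y} k x y z /adjV[_ Vy] _ IH _; exact: IH.
Qed.

Lemma finite_walk k x : finite_set [set y | walk adj k x y].
Proof.
elim: k x => [|k IH] x.
  apply: (sub_finite_set _ (finite_set1 x)) => y /= wxy.
  by inversion wxy.
apply: (@sub_finite_set _ _ (\bigcup_(z in [set z | adj x z]) [set y | walk adj k z y])).
  by move=> y /= wxy; inversion wxy; subst; exists y0.
by apply: bigcup_finite => //; exact: finite_adj.
Qed.

Lemma countable_vertices : countable V.
Proof.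
have [_ _ _ conn [x [_ [Vx _ _]]]] := graphG.
apply: (@sub_countable _ _ _ (\bigcup_(k in [set: nat]) [set y | walk adj k x y])).
  by apply: subset_card_le => y Vy; have [k wk] := conn x y Vx Vy; exists k.
apply: bigcup_countable => [|k _]; first exact: countableP.
exact/finite_set_countable/finite_walk.
Qed.

(** An infimum of walk lengths below [s] is witnessed by a walk shorter than [s], and by local
    finiteness the walks of bounded length from [x] reach finitely many vertices. *)
Lemma finite_ballG x (s : R) : V x -> finite_set (ballG adj V x s).
Proof.
have [_ _ _ conn _] := graphG.
move=> Vx.
apply: (@sub_finite_set _ _ (\bigcup_(k in `I_(Num.truncn s).+1) [set y | walk adj k x y])).
  move=> y [Vy]; rewrite /gdist => /inf_lt[].
    by have [k wk] := conn x y Vx Vy; exists k%:R; exists k.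
  move=> _ [k wk <-] ks; exists k => //=.
  by rewrite -(@ltr_nat R) (lt_trans ks) // truncnS_gt.
by apply: bigcup_finite => [|k _]; [exact: finite_II|exact: finite_walk].
Qed.

Section Weight.
Variable w : E -> E -> R.
Hypothesis wP : weight_on adj w.

Lemma weight_ge0 x y : 0 <= w x y.
Proof.
have [_ w1 w2] := wP.
by have [/w1/ltW//|/w2 ->] := pselect (adj x y).
Qed.

Lemma wdegE x : wdeg w x = \sum_(y \in [set y | adj x y]) w x y.
Proof.
have [_ _ w2] := wP.
by apply/esym/fsbig_widen => // y [_ /= nxy]; exact: w2.
Qed.

Lemma wdeg_ge0 x : 0 <= wdeg w x.
Proof. by apply: fsumr_ge0 => y _; exact: weight_ge0. Qed.

(** A walk to a vertex other than [x] has a first edge, whose weight is positive. *)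
Lemma wdeg_gt0 x : V x -> 0 < wdeg w x.
Proof.
have [_ _ _ conn [x1 [x2 [V1 V2 x12]]]] := graphG; have [_ w1 _] := wP.
move=> Vx.
have [y Vy xy] : exists2 y, V y & x <> y.
  by have [xx1|] := pselect (x = x1); [exists x2 => //; rewrite xx1|exists x1].
have [k wk] := conn x y Vx Vy.
inversion wk; subst => //.
have h : 0 < w x y0 by exact: w1.
rewrite wdegE (fsbigD1 y0) //=; last exact: finite_adj.
by rewrite ltr_wpDr // fsumr_ge0 // => z _; exact: weight_ge0.
Qed.

(** The range of summation becomes a finite set that depends on the graph alone; with random weights
    this makes the sum a fixed finite sum of measurable terms. *)
Lemma tprobS m x y : tprob w m.+1 x y =
  \sum_(z \in [set z | adj x z]) trans w x z * tprob w m z y.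
Proof.
have [_ _ w2] := wP.
by apply/esym/fsbig_widen => // z [_ /= nxz]; rewrite /trans w2 ?mul0r.
Qed.

Lemma tprob_walk m x y : ~ walk adj m x y -> tprob w m x y = 0.
Proof.
elim: m x => [|m IH] x nw /=.
  by have [xy|//] := eqVneq x y; case: nw; rewrite xy; exact: walk0.
rewrite -[LHS]/(tprob w m.+1 x y) tprobS fsbig1 // => z /= xz.
by rewrite IH ?mulr0 // => wz; apply: nw; exact: walkS wz.
Qed.

Lemma walk_hitE m x B :
  walk_hit w m x B = \sum_(y \in B `&` [set y | walk adj m x y]) tprob w m x y.
Proof.
apply/esym/fsbig_widen => [y []//|y [By nw] /=].
by apply: tprob_walk => wy; apply: nw.
Qed.

Lemma sum_qk_wdeg m x B : V x -> finite_set (B `&` V) ->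
  \sum_(y \in B `&` V) qk w m x y * wdeg w y =
  (walk_hit w m x B + walk_hit w m.+1 x B) / 2.
Proof.
move=> Vx finB.
have hitV k : walk_hit w k x B = \sum_(y \in B `&` V) tprob w k x y.
  apply/esym/fsbig_widen => [y []//|y [By nV] /=].
  by apply: tprob_walk => /(walk_stable _ _ _ Vx) Vy; apply: nV.
rewrite !hitV -fsbig_split // mulr_fsuml //; apply: eq_fsbigr => y.
rewrite inE => -[_ Vy]; rewrite /qk /hk -mulrDl mulrAC divfK //.
by rewrite gt_eqF // wdeg_gt0.
Qed.

(** The average hitting probability is the sum of [beta * qk] against the rescaled vertex masses,
    and on [B] the factor [beta * qk] is nearly its value at [z]. *)
Lemma hit_average_near (beta e : R) m x z B :
  V x -> finite_set (B `&` V) -> 0 < beta ->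
  (forall y, B y -> V y -> beta * `|qk w m x y - qk w m x z| <= e) ->
  `|(walk_hit w m x B + walk_hit w m.+1 x B) / 2 -
    beta * qk w m x z * (beta^-1 * \sum_(y \in B `&` V) wdeg w y)| <=
  e * (beta^-1 * \sum_(y \in B `&` V) wdeg w y).
Proof.
move=> Vx finB beta0 near_z; rewrite -sum_qk_wdeg // mulr_fsumr.
rewrite (_ : \sum_(y \in _) qk w m x y * _ =
    \sum_(y \in B `&` V) (beta * qk w m x y) * (beta^-1 * wdeg w y)).
  apply: fsum_near_cst => // y [By Vy].
    by rewrite mulr_ge0 ?wdeg_ge0 // invr_ge0 ltW.
  by rewrite -mulrBr normrM (gtr0_norm beta0) near_z.
by apply: eq_fsbigr => y _; rewrite mulrACA mulfV ?gt_eqF // mul1r.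
Qed.

Lemma gmeasureE B : finite_set (B `&` V) ->
  gmeasure V w B = (\sum_(y \in B `&` V) wdeg w y)%:E.
Proof.
move=> finB; rewrite /gmeasure esum_fset //; last by move=> y _; rewrite lee_fin wdeg_ge0.
by rewrite !fsbig_finite // sumEFin.
Qed.

End Weight.

Section RandomWeight.
Context {dO : measure_display} {Omega : measurableType dO}.
Variable w : Omega -> E -> E -> R.
Hypothesis wP : forall om, weight_on adj (w om).
Hypothesis mw : forall x y, measurable_fun setT (fun om => w om x y).

Lemma measurable_fsum (D : set E) (h : E -> Omega -> R) : finite_set D ->
  (forall y, measurable_fun setT (h y)) ->
  measurable_fun setT (fun om => \sum_(y \in D) h y om).
Proof.
move=> finD mh; under eq_fun do rewrite fsbig_finite //.
exact: measurable_sum.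
Qed.

Lemma measurable_wdeg x : measurable_fun setT (fun om => wdeg (w om) x).
Proof.
under eq_fun do rewrite wdegE//.
by apply: measurable_fsum; first exact: finite_adj.
Qed.

Lemma measurable_inv_wdeg x : measurable_fun setT (fun om => (wdeg (w om) x)^-1).
Proof.
(* For a non-negative base the inverse is the power with exponent -1, a measurable function on the
   whole line. *)
under eq_fun do rewrite -powR_inv1 ?wdeg_ge0//.
apply: (@measurableT_comp _ _ _ _ _ _ (fun t : R => t `^ (-1))).
  exact: measurable_powR.
exact: measurable_wdeg.
Qed.

Lemma measurable_tprob m x y : measurable_fun setT (fun om => tprob (w om) m x y).
Proof.
elim: m x => [|m IH] x; first exact: measurable_cst.
under eq_fun do rewrite tprobS//.
apply: measurable_fsum => [|z]; first exact: finite_adj.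
apply: measurable_funM => //; apply: measurable_funM => //.
exact: measurable_inv_wdeg.
Qed.

Lemma measurable_walk_hit m x B : measurable_fun setT (fun om => walk_hit (w om) m x B).
Proof.
under eq_fun do rewrite walk_hitE//.
apply: measurable_fsum => [|y]; last exact: measurable_tprob.
by apply: finite_setIr; exact: finite_walk.
Qed.

Lemma measurable_qk m x y : measurable_fun setT (fun om => qk (w om) m x y).
Proof.
apply: measurable_funM => //; apply: measurable_funD;
by apply: measurable_funM; [exact: measurable_tprob|exact: measurable_inv_wdeg].
Qed.

End RandomWeight.
End WeightedGraph.

(** * Events and convergence in probability *)

Lemma cvge0_near_lt {R : realType} {T : Type} {G : set_system T}
    (u : T -> \bar R) (e : R) :
  u x @[x --> G] --> 0%E -> 0 < e -> \forall x \near G, (u x < e%:E)%E.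
Proof.
move=> u0 e0; apply: (u0 [set x | (x < e%:E)%E]).
apply: open_nbhs_nbhs; split; last by rewrite /= lte_fin.
exact: open_ereal_lt_ereal.
Qed.

Lemma limn_esup_lt_near {R : realType} (u : nat -> \bar R) (c : \bar R) :
  (limn_esup u < c)%E -> \forall n \near \oo, (u n < c)%E.
Proof.
move=> /ereal_inf_lt[_ [A Aoo <-] Ac].
apply: filterS Aoo => n An; apply: le_lt_trans Ac.
by apply: ereal_sup_ubound; exists n.
Qed.

Lemma open_gt_dist {R : realType} (c : \bar R) (e : R) :
  open [set z : R | (e%:E < `|z%:E - c|)%E].
Proof.
case: c => [c| |] /=; last 2 first.
- rewrite (_ : [set _ | _] = setT); first exact: openT.
  by apply/seteqP; split => // z _ /=; rewrite ltry.
- rewrite (_ : [set _ | _] = setT); first exact: openT.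
  by apply/seteqP; split => // z _ /=; rewrite ltry.
rewrite (_ : [set _ | _] = (fun z => `|z - c|) @^-1` [set x | e < x]); last first.
  by apply/seteqP; split => z /=; rewrite lte_fin.
apply: open_comp => [z _|]; last exact: open_gt.
by apply: cvg_norm; apply: cvgB; [exact: cvg_id|exact: cvg_cst].
Qed.

Lemma gt_ereal_sup_bigcup {R : realType} {T I : Type} (D : set I)
    (f : T -> I -> \bar R) (e : \bar R) :
  [set x | (e < ereal_sup [set f x i | i in D])%E] =
  \bigcup_(i in D) [set x | (e < f x i)%E].
Proof.
apply/seteqP; split => [x /ereal_sup_gtP[_ [i Di <-] ei]|x [i Di ei]].
  by exists i.
by apply/ereal_sup_gtP; exists (f x i) => //; exists i.
Qed.

Lemma gt_ereal_sup2_bigcup {R : realType} {T I J : Type} (A : set I) (B : set J)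
    (f : T -> I -> J -> \bar R) (e : \bar R) :
  [set x | (e < ereal_sup [set ereal_sup [set f x i j | j in B] | i in A])%E] =
  \bigcup_(k in A `*` B) [set x | (e < f x k.1 k.2)%E].
Proof.
rewrite gt_ereal_sup_bigcup; apply/seteqP; split => [x [i Ai]|x [[i j] [/= Ai Bj] H]].
  by move=> /= /ereal_sup_gtP[_ [j Bj <-] H]; exists (i, j).
by exists i => //=; apply/ereal_sup_gtP; exists (f x i j) => //; exists j.
Qed.

Section Events.
Context {R : realType} {dO : measure_display} {Omega : measurableType dO}.

Lemma countable_bigcup_measurable {I : Type} (A : set I) (B : I -> set Omega) :
  countable A -> (forall i, A i -> measurable (B i)) ->
  measurable (\bigcup_(i in A) B i).
Proof.
move=> cA mB; rewrite bigcup_set_type; apply: countable_bigcupT_measurable.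
  by rewrite (eq_countable (card_setT A)).
by move=> i; apply: mB; apply: set_valP.
Qed.

(* For a fixed key k the union of the deviations of the single variable [Z k]
   from arbitrarily many constants is the preimage of one open set; so only the
   set of keys has to be countable. *)
Lemma measurable_bigcup_dist {I K : Type} (D : set I) (key : I -> K)
    (Z : K -> Omega -> R) (c : I -> \bar R) (e : R) :
  countable (key @` D) -> (forall k, measurable_fun setT (Z k)) ->
  measurable (\bigcup_(i in D) [set om | (e%:E < `|(Z (key i) om)%:E - c i|)%E]).
Proof.
move=> cK mZ.
pose O k := \bigcup_(i in [set i | D i /\ key i = k])
  [set z : R | (e%:E < `|z%:E - c i|)%E].
rewrite (_ : \bigcup_(i in D) _ = \bigcup_(k in key @` D) (Z k @^-1` O k)).
  apply: countable_bigcup_measurable => // k _.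
  rewrite -[X in measurable X]setTI; apply: mZ => //.
  by apply: open_measurable; apply: bigcup_open => i _; exact: open_gt_dist.
apply/seteqP; split => [om [i Di H]|om [_ [i Di <-] [j [Dj jk] H]]].
  by exists (key i); [exists i|exists i].
by exists j => //=; rewrite jk.
Qed.

Variable P : probability Omega R.

(** Measurability is asked only eventually: the mass of a metric ball is known to be a finite sum of
    weights only for large [n]. *)
Definition asymptotically_null (A : nat -> set Omega) :=
  (\forall n \near \oo, measurable (A n)) /\ P (A n) @[n --> \oo] --> 0%E.

Lemma asymptotically_nullU A B :
  asymptotically_null A -> asymptotically_null B ->
  asymptotically_null (fun n => A n `|` B n).
Proof.
move=> [mA A0] [mB B0]; split.
  by apply: filterS2 mA mB => n; exact: measurableU.
apply: (@squeeze_cvge _ _ _ _ (cst 0%E) _ (fun n => P (A n) + P (B n))%E).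
- apply: filterS2 mA mB => n mAn mBn.
  by rewrite measure_ge0 /= measureU2.
- exact: cvg_cst.
- by rewrite -[0%E]adde0; apply: cvgeD.
Qed.

Lemma asymptotically_null_bigcup {I : choiceType} (J : set I)
    (A : I -> nat -> set Omega) : finite_set J ->
  (forall i, J i -> asymptotically_null (A i)) ->
  asymptotically_null (fun n => \bigcup_(i in J) A i n).
Proof.
move=> /finite_seqP[s ->]; elim: s => [|i s IH] As.
  under eq_fun do rewrite set_nil bigcup_set0.
  by split; [exact: nearW|rewrite measure0; exact: cvg_cst].
have -> : [set` i :: s] = [set i] `|` [set` s].
  apply/seteqP; split => j /=; rewrite inE; first by case/orP => [/eqP|]; [left|right].
  by case => [->|js]; rewrite ?eqxx // js orbT.
under eq_fun do rewrite bigcup_setU bigcup_set1.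
apply: asymptotically_nullU; first by apply: As; rewrite /= mem_head.
by apply: IH => j js; apply: As; rewrite /= inE; apply/orP; right.
Qed.

(** The limsup of [P (T n)] is at most every [e]. Both covering events may depend on [e]: the
    oscillation event is merely of small probability, and the mesh of the net is chosen after it. *)
Lemma asymptotically_null_cover (T : nat -> set Omega) :
  (forall n, measurable (T n)) ->
  (forall e : R, 0 < e -> exists U B, [/\ asymptotically_null U,
     \forall n \near \oo, measurable (B n),
     \forall n \near \oo, (P (B n) < e%:E)%E &
     \forall n \near \oo, T n `<=` U n `|` B n]) ->
  P (T n) @[n --> \oo] --> 0%E.
Proof.
move=> mT cover; apply: limn_esup_le_cvg => //.
apply/lee_addgt0Pr => e e0; rewrite add0e.
have e20 : 0 < e / 2 by rewrite divr_gt0.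
have [U [B [[mU U0] mB Be TUB]]] := cover _ e20.
rewrite /limn_esup limf_esupE.
apply: ge_ereal_inf; exists (ereal_sup ((fun n => P (T n)) @` [set n | (P (T n) <= e%:E)%E])).
  exists [set n | (P (T n) <= e%:E)%E] => //.
  have Ue := cvge0_near_lt _ _ U0 e20.
  near=> n => /=.
  have mUn : measurable (U n) by near: n.
  have mBn : measurable (B n) by near: n.
  apply: (@le_trans _ _ (P (U n `|` B n))).
    by apply: le_measure; rewrite ?inE //; [exact: measurableU|near: n].
  apply: (le_trans (measureU2 _ mUn mBn)).
  rewrite [e]splitr EFinD; apply: leeD; apply: ltW; by near: n.
by apply: ge_ereal_sup => _ [n Hn <-].
Unshelve. all: by end_near.
Qed.

End Events.

(** * Averages over small balls *)

Section MetricMeasure.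
Context {R : realType} {dm : measure_display} {E : measurableType dm}.
Variables (d : E -> E -> R) (F : set E).
Hypothesis dmet : is_metric d.
Hypothesis borelE : forall A : set E, measurable A <-> <<s dopen d >> A.

Lemma dopen_measurable A : dopen d A -> measurable A.
Proof. by move=> oA; apply/borelE; apply: sub_sigma_algebra. Qed.

Lemma measurable_proper :
  (forall x r, 0 < r -> dcompact d (F `&` cballE d x r)) -> measurable F.
Proof.
move=> cF; rewrite -[F]setCK; apply: measurableC; apply: dopen_measurable.
exact: dopen_setC_proper.
Qed.

(** By continuity each strict superlevel set is the trace on [A] of an open set of [E], a union of
    balls on whose intersection with [F] the density exceeds the level. *)
Lemma measurable_jcont_on (q : R -> E -> R) t A : jcont_on d F q -> 0 < t ->
  A `<=` F -> measurable_fun A (q t).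
Proof.
move=> qc t0 AF mA.
apply: (measurability _ (RGenOInfty.measurableE R)) => //.
move=> /= _ [_ [c ->] <-]; rewrite preimage_itvoy.
pose O := [set y | exists x r, d x y < r /\
  forall z, F z -> d x z < r -> c < q t z].
rewrite (_ : _ `&` _ = A `&` O); last first.
  apply/seteqP; split => y [Ay] /= => [qy|[x [r [xy H]]]]; last first.
    by split => //; apply: H => //; exact: AF.
  split => //; have e0 : 0 < q t y - c by rewrite subr_gt0.
  have [del del0 H] := qc t y t0 (AF _ Ay) _ e0.
  exists y, del; split; first by have [_ d0 _ _] := dmet; rewrite (d0 y y).2.
  move=> z Fz yz; have := H t z t0 Fz; rewrite subrr normr0 => /(_ del0 yz).
  by rewrite ltr_norml => /andP[H1 _]; lra.
apply: measurableI => //; apply: dopen_measurable => y [x [r [xy H]]].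
have [s s0 sr] := dopen_ballE d x r dmet y xy.
by exists s => // z /sr xz; exists x, r.
Qed.

Lemma integral_near_cst (nu : {measure set E -> \bar R}) (f : E -> R) A
    (v e N : R) :
  measurable A -> measurable_fun A f -> nu A = N%:E ->
  (forall y, A y -> 0 <= f y) -> (forall y, A y -> `|f y - v| <= e) ->
  exists2 I : R, (\int[nu]_(y in A) (f y)%:E = I%:E)%E &
    `|I - v * N| <= e * N.
Proof.
move=> mA mf nuA f0 fv.
have N0 : 0 <= N by rewrite -lee_fin -nuA.
have mfE : measurable_fun A (fun y => (f y)%:E) by apply/measurable_EFinP.
have ub : (\int[nu]_(y in A) (f y)%:E <= ((v + e) * N)%:E)%E.
  rewrite EFinM -nuA -integral_cst //; apply: ge0_le_integral => //.
  by move=> y Ay; rewrite lee_fin; have := fv y Ay; rewrite ler_norml => /andP[]; lra.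
have ge0 : (0 <= \int[nu]_(y in A) (f y)%:E)%E.
  by apply: integral_ge0 => y Ay; rewrite lee_fin f0.
have lb : (((v - e) * N)%:E <= \int[nu]_(y in A) (f y)%:E)%E.
  (* Comparison of integrals is used for non-negative functions only, so a non-positive lower
     constant is treated apart. *)
  have [ve|ve] := lerP (v - e) 0.
    by apply: le_trans ge0; rewrite lee_fin mulr_le0_ge0.
  rewrite EFinM -nuA -integral_cst //; apply: ge0_le_integral => //.
  - by move=> y Ay; rewrite lee_fin ltW.
  - by move=> y Ay; rewrite lee_fin; have := fv y Ay; rewrite ler_norml => /andP[]; lra.
move: ub ge0 lb; case: integral => [I| |] //.
rewrite !lee_fin => ub ge0 lb; exists I => //.
by rewrite ler_norml; apply/andP; split; nra.
Qed.

End MetricMeasure.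

(* [Z] and [v] stand for the rescaled discrete density and the limit density,
   [M] and [N] for the masses of a ball, [h0], [h1] for the hitting
   probabilities of the ball at two consecutive times, and [i0], [i1] for the
   corresponding integrals of the limit density. *)
Lemma density_quotient_estimate {R : realType} (Z v M N h0 h1 i0 i1 e Q : R) :
  0 < N -> 0 < e -> `|v| <= Q ->
  `|M - N| <= N / 2 -> `|M - N| * (Q + 1) <= N * e / 8 ->
  `|(h0 + h1) / 2 - Z * M| <= e / 6 * M ->
  `|h0 - i0| <= N * e / 8 -> `|h1 - i1| <= N * e / 8 ->
  `|i0 - v * N| <= e / 6 * N -> `|i1 - v * N| <= e / 6 * N ->
  `|Z - v| <= e.
Proof.
move=> N0 e0 vQ MN MNQ HZ H0 H1 I0 I1.
have M0 : N / 2 <= M by move: MN; rewrite ler_norml => /andP[]; lra.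
have Mpos : 0 < M by lra.
have vMN : `|v * (M - N)| <= N * e / 8.
  rewrite normrM mulrC; apply: le_trans MNQ.
  by rewrite ler_wpM2l // (le_trans vQ) // lerDl.
rewrite -(ler_pM2r Mpos) -{1}(ger0_norm (ltW Mpos)) -normrM.
(* The errors add up to [e * M / 6] from the oscillation, [N * e / 8] each from hitting and from
   mass, and [N * e / 6] from the integrals; with [N <= 2 * M] the total is at most [e * M]. *)
have NM : N * e <= 2 * (e * M) by nra.
move: HZ H0 H1 I0 I1 vMN NM; rewrite !ler_norml.
move=> /andP[? ?] /andP[? ?] /andP[? ?] /andP[? ?] /andP[? ?] /andP[? ?] ?.
by apply/andP; split; lra.
Qed.

(* If [mass] were infinite, the deviation would be infinite and the event would
   have probability one. *)
Lemma local_mass_finite {R : realType} {dm : measure_display}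
    {E : measurableType dm} {dO : measure_display} {Omega : measurableType dO}
    (P : probability Omega R) (beta : nat -> R) (G : nat -> Omega -> \bar R)
    (mass : \bar R) (e : R) : (0 <= mass)%E ->
  P [set om | (e%:E < `|(beta n)^-1%:E * G n om - mass|)%E] @[n --> \oo] --> 0%E ->
  mass \is a fin_num.
Proof.
case: mass => [//|_|//].
under eq_fun => n.
  rewrite (_ : [set om | _] = setT); last first.
    by apply/seteqP; split => // om _ /=; rewrite addeNy /= ltry.
  rewrite probability_setT.
  over.
move=> /(cvge0_near_lt _ (1 : R)) /(_ ltr01) H.
have [n] : exists n : nat, ((1 : \bar R) < 1%:E)%E by apply: (filter_ex H).
by rewrite ltxx.
Qed.

(** * Measurability of the events *)

Section RandomEvents.
Context {R : realType} {E : choiceType} {dO : measure_display}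
  {Omega : measurableType dO}.
Variables (V : set E) (adj : E -> E -> Prop) (w : Omega -> E -> E -> R).
Hypothesis graphG : lf_conn_graph V adj.
Hypothesis wP : forall om, weight_on adj (w om).
Hypothesis mw : forall x y, measurable_fun setT (fun om => w om x y).

Lemma measurable_mass_event (B : set E) (beta e : R) (N : \bar R) :
  finite_set (B `&` V) ->
  measurable [set om | (e%:E < `|(beta^-1)%:E * gmeasure V (w om) B - N|)%E].
Proof.
move=> finB.
pose Z om := beta^-1 * \sum_(y \in B `&` V) wdeg (w om) y.
rewrite (_ : [set _ | _] =
    setT `&` Z @^-1` [set z | (e%:E < `|z%:E - N|)%E]); last first.
  by rewrite setTI; apply/seteqP; split => om /=; rewrite (gmeasureE V adj _ (wP om)).
have mZ : measurable_fun setT Z.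
  apply: measurable_funM => //; apply: measurable_fsum => // y.
  exact: (measurable_wdeg V adj).
by apply: mZ => //; apply: open_measurable; exact: open_gt_dist.
Qed.

Lemma measurable_hit_event (rho : E) (B : set E) (gamma e : R) (I : set R)
    (c : R -> \bar R) :
  measurable [set om | (e%:E < ereal_sup
    [set `|(walk_hit (w om) (Num.truncn (gamma * t)) rho B)%:E - c t|%E | t in I])%E].
Proof.
rewrite gt_ereal_sup_bigcup.
apply: (measurable_bigcup_dist I (fun t => Num.truncn (gamma * t))
  (fun k om => walk_hit (w om) k rho B) c e); first exact: countableP.
by move=> k; exact: (measurable_walk_hit V adj).
Qed.

Lemma measurable_oscillation_event (rho : E) (beta gamma e : R)
    (A : set (E * E)) (I : set R) : 0 <= beta -> A `<=` V `*` V ->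
  measurable [set om | (e%:E < ereal_sup [set ereal_sup
    [set (beta * `|qk (w om) (Num.truncn (gamma * t)) rho xy.1
                 - qk (w om) (Num.truncn (gamma * t)) rho xy.2|)%:E | t in I]
    | xy in A])%E].
Proof.
move=> beta0 AV; rewrite gt_ereal_sup2_bigcup.
pose key (i : E * E * R) := (i.1, Num.truncn (gamma * i.2)).
pose Z (k : E * E * nat) om :=
  beta * `|qk (w om) k.2 rho k.1.1 - qk (w om) k.2 rho k.1.2|.
rewrite (_ : \bigcup_(k in _) _ = \bigcup_(i in A `*` I)
    [set om | (e%:E < `|(Z (key i) om)%:E - 0%:E|)%E]); last first.
  apply: eq_bigcupr => i _; apply: eq_set => om.
  by rewrite sube0 /Z abse_EFin ger0_norm ?mulr_ge0.
apply: measurable_bigcup_dist => [|k].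
  have cV := countable_vertices V adj graphG.
  apply: (@sub_countable _ _ _ ((V `*` V) `*` [set: nat])).
    by apply: subset_card_le => _ [i [/AV Ai _] <-].
  by do 2![apply: countableX => //]; exact: countableP.
apply: measurable_funM => //; apply: measurableT_comp => //.
by apply: measurable_funB; exact: (measurable_qk V adj).
Qed.

(** The limit values [q t x] are uncountably many, but the random part depends only on the vertex
    [g x] and an integer time, so the keys are countable. *)
Lemma measurable_density_event (rho : E) (beta gamma e : R) (g : E -> E)
    (q : R -> E -> R) (A : set E) (I : set R) : (forall x, V (g x)) ->
  measurable [set om | (e%:E < ereal_sup [set ereal_sup
    [set `|beta * qk (w om) (Num.truncn (gamma * t)) rho (g x) - q t x|%:E | t in I]
    | x in A])%E].
Proof.
move=> gV; rewrite gt_ereal_sup2_bigcup.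
pose key (i : E * R) := (g i.1, Num.truncn (gamma * i.2)).
apply: (measurable_bigcup_dist (A `*` I) key
  (fun k om => beta * qk (w om) k.2 rho k.1) (fun i => (q i.2 i.1)%:E) e) => [|k].
  have cV := countable_vertices V adj graphG.
  apply: (@sub_countable _ _ _ (V `*` [set: nat])).
    by apply: subset_card_le => _ [i _ <-]; split => //=.
  by apply: countableX => //; exact: countableP.
by apply: measurable_funM => //; exact: (measurable_qk V adj).
Qed.

End RandomEvents.

(** * The local limit theorem for random weights *)

Theorem theorem6p1 (R : realType)
  (dm : measure_display) (E : measurableType dm) (dE : E -> E -> R)
  (F : set E) (rho : E) (nu : {measure set E -> \bar R}) (q : R -> E -> R)
  (V : nat -> set E) (adj : nat -> E -> E -> Prop)
  (dO : measure_display) (Omega : measurableType dO) (P : probability Omega R)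
  (w : nat -> Omega -> E -> E -> R)
  (alpha beta gamma : nat -> R) (g : nat -> E -> E)
  (a b r eps : R) :
  (* (E, d_E) metric space, Borel sigma-algebra *)
  is_metric dE ->
  (forall A : set E, measurable A <-> <<s dopen dE >> A) ->
  (* F \cap closed balls compact *)
  (forall (x : E) (s : R), 0 < s -> dcompact dE (F `&` cballE dE x s)) ->
  F rho ->
  (* nu: Radon measure of full support on (F, d_F), extended to E *)
  (forall A, measurable A -> nu A = nu (A `&` F)) ->
  radon_on dE F nu -> full_support dE F nu ->
  (* heat kernel q *)
  (forall t x, 0 < t -> F x -> 0 <= q t x) ->
  (forall t, 0 < t -> (\int[nu]_(x in F) (q t x)%:E = 1)%E) ->
  jcont_on dE F q ->
  (* graphs G^n, rooted at rho, vertices in E *)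
  (forall n, lf_conn_graph (V n) (adj n)) ->
  (forall n, V n rho) ->
  (* random weights *)
  (forall n om, weight_on (adj n) (w n om)) ->
  (forall n x y, measurable_fun setT (fun om => w n om x y)) ->
  (* scaling sequences *)
  (forall n, 0 <= alpha n) -> (forall n, 0 <= beta n) -> (forall n, 0 <= gamma n) ->
  alpha n @[n --> \oo] --> +oo -> beta n @[n --> \oo] --> +oo ->
  gamma n @[n --> \oo] --> +oo ->
  (* g_n(x) : a point of V(G^n) minimising d_E(x, .) *)
  (forall n x, V n (g n x) /\ forall v, V n v -> dE x (g n x) <= dE x v) ->
  A1R dE F rho nu q V adj P w alpha beta gamma ->
  A2R rho V adj P w alpha beta gamma ->
  0 < a -> a <= b -> 0 < r -> 0 < eps ->
  P [set om | (eps%:E < ereal_sup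
      [set ereal_sup
         [set `| beta n * qk (w n om) (Num.truncn (gamma n * t)) rho (g n x) - q t x |%:E
         | t in `[a, b]]
      | x in ballF dE F rho r])%E]
    @[n --> \oo] --> 0%E.
Proof.
move=> dmet borelE cF Frho nuF _ nu_supp q0 _ qc graphG Vrho wP mw
  alpha0 beta0 gamma0 alpha_oo beta_oo gamma_oo gP.
move=> [[[c1 _ _] [alphat [alphat0 /eqoP alphato metric_ub]]] fill mass hit].
move=> A2 a0 ab r0 eps0.
have [d_ge0 d_eq0 d_sym d_tri] := dmet.
have mF : measurable F by exact: (measurable_proper dE F).
pose K := F `&` cballE dE rho r.
have cK : dcompact dE K by exact: cF.
have KF : K `<=` F by move=> x [].
have eps60 : 0 < eps / 6 by rewrite divr_gt0.
have [del1 del10 q_unif] :=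
  @jcont_on_uniform _ _ _ dE F q dmet qc K a (b + 1) (eps / 6) cK KF a0 eps60.
have [Q q_bd] := @jcont_on_bounded _ _ _ dE F q dmet qc K a b cK KF a0.
have Q0 : 0 <= Q.
  apply: le_trans (q_bd rho a _ _) => //; last by rewrite lexx ab.
  by split => //; rewrite /cballE /= (d_eq0 rho rho).2 // ltW.
have r20 : 0 < r + 2 by rewrite addr_gt0.
have [c2' [n0 metric_ub']] := metric_ub _ r20.
pose c2 : R := `|c2'|.
have c20 : 0 <= c2 by exact: normr_ge0.
(* On the metric ball of radius [r + 2] graph distances from [rho] will be at most
   [alpha n * (c2 * (r + 2) + del)], with [del] below 2. *)
pose r' := c2 * (r + 2) + 2.
have r'0 : 0 < r'.
  by apply: ltr_wpDl => //; rewrite mulr_ge0 // ltW.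
apply: asymptotically_null_cover => [n|e e0].
  by apply: (measurable_density_event (V n) (adj n)) => // x; have [] := gP n x.
pose bad3 (delta : R) n := [set om | ((eps / 6)%:E < ereal_sup
  [set ereal_sup
    [set (beta n * `| qk (w n om) (Num.truncn (gamma n * t)) rho xy.1
                    - qk (w n om) (Num.truncn (gamma n * t)) rho xy.2 |)%:E
    | t in `[a, b]]
  | xy in [set xy : E * E |
      [/\ ballG (adj n) (V n) rho (alpha n * r')%R xy.1,
          ballG (adj n) (V n) rho (alpha n * r')%R xy.2 &
          (gdist (adj n) xy.1 xy.2 <= alpha n * delta)%R]]])%E].
have [del3 [del30 A2_del3]] : exists del3 : R,
    0 < del3 /\ (limn_esup (fun n => P (bad3 del3 n)) < e%:E)%E.
  have H := cvge0_near_lt _ e (A2 a b r' (eps / 6) a0 ab r'0 eps60) e0.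
  apply: (@filter_ex _ ((0:R)^'+)); apply: filterI H.
  exact: nbhs_right_gt.
(* Two points of a net ball are then within [del1]; all points used stay within [r + 2] of [rho];
   and metric distance [3 * del] plus the additive error [del] gives graph distance at most
   [alpha n * del3]. *)
pose del := Num.min (Num.min (del1 / 2) (1 / 2)) (del3 / (3 * c2 + 1)).
have c2D : 0 < 3 * c2 + 1 by rewrite ltr_wpDl // mulr_ge0.
have del0 : 0 < del by rewrite !lt_min !divr_gt0.
have del_del1 : del <= del1 / 2 by rewrite /del !ge_min lexx.
have del_1 : del <= 1 / 2 by rewrite /del !ge_min lexx orbT.
have del_del3 : (3 * c2 + 1) * del <= del3.
  by rewrite mulrC -ler_pdivlMr // /del !ge_min lexx !orbT.
have [J [finJ JK netJ]] := dcompact_net dE K del dmet cK del0.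
pose B i := Defs.ballE dE i del.
pose N i := fine (nu (B i)).
have mB i : measurable (B i).
  by apply: (dopen_measurable dE) => //; exact: dopen_ballE.
have nuB i : J i -> nu (B i) = (N i)%:E.
  move=> Ji; rewrite fineK //.
  by apply: (local_mass_finite P _ _ _ _ (measure_ge0 nu _))
    (mass i del 1 (KF _ (JK _ Ji)) del0 ltr01).
have N0 i : J i -> 0 < N i.
  move=> Ji; rewrite -lte_fin -nuB // nuF //; apply: nu_supp.
    split=> [y []//|y [iy Fy]]; have [s s0 Hs] := dopen_ballE dE i del dmet y iy.
    by exists s => // z [yz Fz]; split => //; exact: Hs.
  exists i; split; last exact: KF (JK _ Ji).
  by rewrite /B /Defs.ballE /= (d_eq0 i i).2.
(* The two terms supply the two mass conditions of [density_quotient_estimate]; [Q + 1] is positive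
   even if [Q] vanishes. *)
pose eta1 i := Num.min (N i / 2) (N i * eps / (8 * (Q + 1))).
pose eta2 i := N i * eps / 8.
have Q10 : 0 < 8 * (Q + 1) by rewrite mulr_gt0 // ltr_wpDl.
have eta10 i : J i -> 0 < eta1 i.
  by move=> Ji; have Ni := N0 i Ji; rewrite lt_min !divr_gt0 // mulr_gt0.
have eta20 i : J i -> 0 < eta2 i.
  by move=> Ji; have Ni := N0 i Ji; rewrite divr_gt0 // mulr_gt0.
pose bad1 i n := [set om | ((eta1 i)%:E <
  `|((beta n)^-1)%:E * gmeasure (V n) (w n om) (B i) - nu (B i)|)%E].
(* The interval extends to [b + 1] because the hitting probability is also needed at time
   [t + (gamma n)^-1], which may exceed [b]. *)
pose bad2 i n := [set om | ((eta2 i)%:E < ereal_sup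
  [set `|(walk_hit (w n om) (Num.truncn (gamma n * t)) rho (B i))%:E
         - \int[nu]_(y in B i `&` F) (q t y)%:E|%E | t in `[a, (b + 1)%R]])%E].
have alpha_pos : \forall n \near \oo, 0 < alpha n.
  exact: cvgry_gt.
have beta_pos : \forall n \near \oo, 0 < beta n.
  exact: cvgry_gt.
(* The time shift [(gamma n)^-1] must be below both 1, to stay in [[a, b + 1]], and [del1]. *)
have gamma_big : \forall n \near \oo, Num.max 1 del1^-1 < gamma n.
  exact: cvgry_gt.
have n0_le : \forall n \near \oo, (n0 <= n)%N by exists n0.
have alphat_small : \forall n \near \oo, alphat n <= del * alpha n.
  by apply: filterS (alphato del del0) => n; rewrite !ger0_norm.
have dist_small : \forall n \near \oo, forall x, ballF dE F rho r x -> dE x (g n x) < del.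
  apply: filterS (cvge0_near_lt _ del (fill r r0) del0) => n Hn x Fx.
  rewrite -lte_fin; apply: le_lt_trans Hn.
  apply: (@le_trans _ _ (dist_set dE (V n) x)%:E).
    rewrite lee_fin; apply: lb_le_inf; first by exists (dE x rho), rho.
    by move=> _ [v Vv <-]; exact: (gP n x).2.
  by apply: ereal_sup_ubound; exists x.
have dG_ub n x y : (n0 <= n)%N -> alphat n <= del * alpha n ->
    V n x -> V n y -> dE rho x < r + 2 -> dE rho y < r + 2 ->
    gdist (adj n) x y <= alpha n * (c2 * dE x y + del).
  move=> n0n small Vx Vy rx ry; apply: le_trans (metric_ub' n n0n x y Vx Vy rx ry) _.
  have : c2' * (alpha n * dE x y) <= c2 * (alpha n * dE x y).
    by rewrite ler_wpM2r ?mulr_ge0 // ler_norm.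
  lra.
have ball_ballG n y : (n0 <= n)%N -> alphat n <= del * alpha n -> 0 < alpha n ->
    V n y -> dE rho y < r + 2 -> ballG (adj n) (V n) rho (alpha n * r') y.
  move=> n0n small an0 Vy ry; split => //.
  apply: le_lt_trans (dG_ub n rho y n0n small (Vrho n) Vy _ ry) _.
    by rewrite (d_eq0 rho rho).2.
  rewrite ltr_pM2l // /r'.
  have : c2 * dE rho y <= c2 * (r + 2) by rewrite ler_wpM2l // ltW.
  lra.
have B_near i y : J i -> B i y -> dE rho y < r + 2.
  move=> /JK[_]; rewrite /cballE /B /Defs.ballE /= => ri iy.
  by have := d_tri rho i y; lra.
(* The upper bound on graph distances puts the vertices of each net ball into one graph ball, which
   is finite. *)
have finBV : \forall n \near \oo, forall i, J i -> finite_set (B i `&` V n).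
  near=> n => i Ji.
  apply: (@sub_finite_set _ _ (ballG (adj n) (V n) rho (alpha n * r'))).
    move=> y [By Vy]; apply: ball_ballG => //; last exact: B_near By.
    - by near: n.
    - by near: n.
    - by near: n.
  exact: finite_ballG.
pose U n := \bigcup_(i in J) (bad1 i n `|` bad2 i n).
exists U, (bad3 del3); split.
- apply: asymptotically_null_bigcup => // i Ji; apply: asymptotically_nullU; split.
  + apply: filterS finBV => n /(_ i Ji) finB.
    exact: (measurable_mass_event (V n) (adj n)).
  + by apply: mass; [exact: KF (JK _ Ji)| |exact: eta10].
  + by apply: nearW => n; exact: (measurable_hit_event (V n) (adj n)).
  + apply: hit => //; [|exact: KF (JK _ Ji)|exact: eta20].
    by rewrite (le_trans ab) // lerDl.
- apply: nearW => n; apply: (measurable_oscillation_event (V n) (adj n)) => //.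
  by move=> xy [[V1 _] [V2 _] _].
- exact: limn_esup_lt_near A2_del3.
(* From here the argument is deterministic: off the exceptional events, the deviation at every [x]
   and [t] is shown to be at most [eps]. *)
near=> n => om /= /ereal_sup_gtP[_ [x Fx <-] /ereal_sup_gtP[_ [t tab <-]]].
rewrite lte_fin => big; apply: contrapT => /not_orP [nU nB].
move: big; apply/negP; rewrite -leNgt.
have n0n : (n0 <= n)%N by near: n.
have small : alphat n <= del * alpha n by near: n.
have an0 : 0 < alpha n by near: n.
have bn0 : 0 < beta n by near: n.
have finB : forall i, J i -> finite_set (B i `&` V n) by near: n.
have xg : dE x (g n x) < del.
  by move: x Fx {nU nB}; near: n.
have : Num.max 1 del1^-1 < gamma n by near: n.
rewrite gt_max => /andP[g1 gdel].
have g0 : 0 < gamma n by lra.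
have Vg : V n (g n x) by have [] := gP n x.
have [rx FFx] := Fx; rewrite /Defs.ballE /= in rx.
have Kx : K x by split => //; exact: ltW.
have [i Ji ix] := netJ x Kx.
move: (tab); rewrite /= in_itv /= => /andP[at_ tb].
have t0 : 0 < t by exact: lt_le_trans at_.
have gi1 : (gamma n)^-1 < 1 by rewrite invf_lt1.
have gid : (gamma n)^-1 < del1 by rewrite invf_plt.
have gi0 : 0 < (gamma n)^-1 by rewrite invr_gt0.
pose m := Num.truncn (gamma n * t).
(* The shift by [(gamma n)^-1] is exactly one step of the walk, so the second half of [qk] is
   covered by the same hitting hypothesis. *)
have mS : Num.truncn (gamma n * (t + (gamma n)^-1)) = m.+1.
  rewrite mulrDr mulfV ?gt_eqF // addrC truncnD ?truncn1 //.
  by rewrite qualifE /= mulr_ge0 // ltW.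
have mean s : 0 < s -> `|s - t| < del1 -> exists2 Is : R,
    (\int[nu]_(y in B i `&` F) (q s y)%:E = Is%:E)%E &
    `|Is - q t x * N i| <= eps / 6 * N i.
  move=> s0 st; apply: integral_near_cst.
  - exact: measurableI.
  - by apply: (measurable_jcont_on dE F).
  - by rewrite -nuF // nuB.
  - by move=> y [_ Fy]; exact: q0.
  - move=> y [iy Fy]; apply: ltW; apply: q_unif => //.
      by rewrite at_ /= (le_trans tb) // lerDl.
    have := d_tri x i y; rewrite (d_sym x i); rewrite /B /Defs.ballE /= in iy.
    lra.
have hit_le s : a <= s <= b + 1 ->
    (`|(walk_hit (w n om) (Num.truncn (gamma n * s)) rho (B i))%:E -
       \int[nu]_(y in B i `&` F) (q s y)%:E| <= (eta2 i)%:E)%E.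
  move=> sab; rewrite leNgt; apply/negP => H; apply: nU; exists i => //; right.
  apply/ereal_sup_gtP; eexists; last exact: H.
  by exists s => //; rewrite /= in_itv.
have mass_le : `|(beta n)^-1 * (\sum_(y \in B i `&` V n) wdeg (w n om) y) - N i|
    <= eta1 i.
  rewrite -lee_fin leNgt; apply/negP => H; apply: nU; exists i => //; left.
  rewrite /bad1 /= (gmeasureE (V n) (adj n)) //; last exact: finB.
  by rewrite nuB.
have osc y : B i y -> V n y ->
    beta n * `|qk (w n om) m rho y - qk (w n om) m rho (g n x)| <= eps / 6.
  move=> By Vy; rewrite -lee_fin leNgt; apply/negP => H; apply: nB.
  rewrite /bad3 gt_ereal_sup2_bigcup; exists ((y, g n x), t); last exact: H.
  split=> //=.
  have ry := B_near i y Ji By.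
  have rg : dE rho (g n x) < r + 2 by have := d_tri rho x (g n x); lra.
  split; [exact: ball_ballG|exact: ball_ballG|].
  apply: le_trans (dG_ub n _ _ n0n small Vy Vg ry rg) _.
  rewrite ler_pM2l //; apply: le_trans del_del3.
  (* The path goes from [y] to the centre [i], then to [x], then to [g n x], each leg shorter than
     [del]. *)
  have yg : dE y (g n x) <= 3 * del.
    rewrite /B /Defs.ballE /= (d_sym i) in By.
    by have := d_tri y i (g n x); have := d_tri i x (g n x); lra.
  have : c2 * dE y (g n x) <= c2 * (3 * del) by rewrite ler_wpM2l.
  lra.
have avg := hit_average_near (V n) (adj n) (graphG n) _ (wP n om) _ _ m rho _ _
  (Vrho n) (finB i Ji) bn0 osc.
have [|I0 I0E I0le] := mean t t0; first by rewrite subrr normr0.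
have [||I1 I1E I1le] := mean (t + (gamma n)^-1).
- exact: addr_gt0.
- by rewrite addrAC subrr add0r gtr0_norm.
have : `|walk_hit (w n om) m rho (B i) - I0| <= eta2 i.
  rewrite -lee_fin; have := hit_le t; rewrite I0E; apply.
  by rewrite at_ /= (le_trans tb) // lerDl.
have : `|walk_hit (w n om) m.+1 rho (B i) - I1| <= eta2 i.
  rewrite -lee_fin; have := hit_le (t + (gamma n)^-1); rewrite mS I1E; apply.
  by apply/andP; split; lra.
move=> h1 h0; have := q_bd x t Kx; rewrite at_ tb => /(_ isT) Qt.
apply: (density_quotient_estimate _ _ _ _ _ _ _ _ _ _ (N0 i Ji) eps0 Qt) avg h0 h1 I0le I1le.
  by apply: le_trans mass_le _; rewrite /eta1 ge_min lexx.
have H : eta1 i <= N i * eps / (8 * (Q + 1)) by rewrite /eta1 ge_min lexx orbT.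
by have := le_trans mass_le H; rewrite ler_pdivlMr //; lra.
Unshelve. all: by end_near.
Qed.
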